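(* Let $N\in\mathbb{N}$, let $w=(w_1,\dots,w_N)$ and $p=(p_1,\dots,p_N)$ be probability vectors with strictly positive entries, and let $\lambda>0$. Let $T_1,\dots,T_N$ be independent with $T_i\sim\mathrm{Exp}(\lambda p_i)$ (rate $\lambda p_i$), and let $M_N$, $m_N$, $\tau_{N,\theta}$, $t_{N,\theta}$, $w_N^\ast$ be as defined in the context. Fix $\theta\in(0,1)$ and $0<\delta<t_{N,\theta}$, and define \[ \Delta_{N,\theta}(\delta):=\min\bigl\{\theta-m_N(t_{N,\theta}-\delta),\; m_N(t_{N,\theta}+\delta)-\theta\bigr\}. \] Then $\Delta_{N,\theta}(\delta)>0$ and \[ \mathbb{P}\bigl(|\tau_{N,\theta}-t_{N,\theta}|>\delta\bigr)\le 4\exp\left(-\frac{\Delta_{N,\theta}(\delta)^2}{2w_N^\ast+\frac23 w_N^\ast\,\Delta_{N,\theta}(\delta)}\right). \]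
   Context: Discovered-mass process: $M_N(t)=\sum_{i=1}^N w_i\mathbf{1}_{\{T_i\le t\}}$ for $t\ge0$. Mean profile: $m_N(t)=\mathbb{E}[M_N(t)]=\sum_{i=1}^N w_i(1-e^{-\lambda p_i t})$, which is continuous and strictly increasing from $0$ to $1$ on $[0,\infty)$. Quorum time: $\tau_{N,\theta}=\inf\{t\ge0: M_N(t)>\theta\}$. Deterministic comparison time: $t_{N,\theta}=m_N^{-1}(\theta)$, the unique $t$ with $m_N(t)=\theta$. Maximal weight: $w_N^\ast=\max_{1\le i\le N}w_i$. *)

(* Defs.v *)
From HB Require Import structures.
From mathcomp Require Import all_boot all_order all_algebra.
From mathcomp Require Import all_classical all_reals all_analysis.
Set Implicit Arguments.
Unset Strict Implicit.
Unset Printing Implicit Defensive.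
Import Order.TTheory GRing.Theory Num.Theory.
Import numFieldNormedType.Exports.
Local Open Scope classical_set_scope.
Local Open Scope ring_scope.

(* The product rule is required for every finite subfamily J. *)
Definition mutually_independent (d : measure_display) (Omega : measurableType d)
    (R : realType) (P : probability Omega R) (I : finType)
    (X : I -> {RV P >-> R}) : Prop :=
  forall (J : {set I}) (A : I -> set R),
    (forall i, i \in J -> measurable (A i)) ->
    P (\bigcap_(i in [set` J]) (X i @^-1` A i)) =
    (\prod_(i in J) P (X i @^-1` A i))%E.

(* exponential_prob is only meaningful on measurable sets. *)
Definition exponentially_distributed (d : measure_display)
    (Omega : measurableType d) (R : realType) (P : probability Omega R)
    (X : {RV P >-> R}) (rate : R) : Prop :=
  forall A : set R, measurable A -> distribution P X A = exponential_prob rate A.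

Definition positive_probability_vector (R : realType) (N : nat)
    (w : 'I_N -> R) : Prop :=
  (forall i, 0 < w i) /\ \sum_(i < N) w i = 1.

Section QuorumTime.
Context (d : measure_display) (Omega : measurableType d) (R : realType)
        (P : probability Omega R) (N : nat).
Variables (w : 'I_N -> R) (T : 'I_N -> {RV P >-> R}).

Definition discovered_mass (t : R) : Omega -> R :=
  fun omega => \sum_(i < N) w i * \1_[set u | T i u <= t] omega.

Definition mean_profile (t : R) : R := fine ('E_P[discovered_mass t]).

(* For weights summing to 1 and theta < 1 the set is never empty, and it is bounded below by 0, so the
   infimum in R is the true one: the T i are finite, so the discovered mass
   eventually equals 1 for every omega. *)
Definition quorum_time (theta : R) : Omega -> R :=
  fun omega => inf [set t | 0 <= t /\ theta < discovered_mass t omega].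

(* Inverse of the mean profile on [0, +oo[.  For 0 < theta < 1 and exponential
   T i (and weights summing to 1) the solution exists and is unique; the default 0 of xget is then not
   used. *)
Definition comparison_time (theta : R) : R :=
  xget 0 [set t | 0 <= t /\ mean_profile t = theta].

(* Base value 0 is harmless: weights are positive. *)
Definition max_weight : R := \big[Num.max/0]_(i < N) w i.

Definition profile_gap (theta delta : R) : R :=
  Num.min (theta - mean_profile (comparison_time theta - delta))
          (mean_profile (comparison_time theta + delta) - theta).

End QuorumTime.

(* Main.v *)
Require Import Defs.
From mathcomp Require Import all_boot all_order all_algebra.
From mathcomp Require Import all_classical all_reals all_analysis.
From mathcomp Require Import measurable_realfun ring lra.
Import Order.TTheory GRing.Theory Num.Theory.
Import numFieldNormedType.Exports.
Local Open Scope classical_set_scope.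
Local Open Scope ring_scope.
Set Implicit Arguments.
Unset Strict Implicit.
Unset Printing Implicit Defensive.

(* By monotonicity of the discovered mass, tau > t + delta forces
   M(t + delta) <= theta and tau < t - delta forces M(t - delta) > theta; in
   both cases M deviates from its mean by at least Delta.  Since M(s) is
   determined by the random set of indices found by time s, whose law is an
   explicit product, the deviation probability is a finite sum over subsets, to
   which Chernoff's method applies.  As Delta <= 1/2, the tilting parameter
   Delta / wmax keeps all exponents in [-1/2, 1/2]; with the variance bound
   q (1 - q) <= 1/4 this gives exp (- Delta^2 / (2 wmax)) for each tail, which
   is stronger than the Bernstein form of the bound. *)

(** * Exponential moments and a Chernoff bound for weighted Bernoulli sums *)

(** From [1 - x <= expR (- x)] one gets [expR x * (1 - x) <= 1], while [(1 + x + 2 * x ^+ 2) * (1 -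
    x) = 1 + x ^+ 2 * (1 - 2 * x)], which is at least 1 for [x <= 1/2]. *)
Lemma expR_le_quadratic (R : realType) (x : R) :
  `|x| <= 2^-1 -> expR x <= 1 + x + 2 * x ^+ 2.
Proof.
rewrite ler_norml => /andP[x1 x2].
have h := expR_ge1Dx (- x).
have e := expRxMexpNx_1 x.
have le1 : expR x * (1 - x) <= 1 by rewrite -[leRHS]e ler_pM2l ?expR_gt0.
have x1_gt0 : 0 < 1 - x by lra.
rewrite -(ler_pM2r x1_gt0); apply: (le_trans le1).
have x2_le1 : 0 <= 1 - 2 * x by lra.
have h0 := mulr_ge0 (sqr_ge0 x) x2_le1.
lra.
Qed.

(** Dividing by [expR (u * q)] centers the variable. In the quadratic bounds for its two values the
    linear terms cancel and the rest adds up to [2 * u ^+ 2 * (q * (1 - q))], at most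
    [u ^+ 2 / 2]. *)
Lemma bernoulli_mgf_le (R : realType) (q u : R) :
  0 <= q <= 1 -> `|u| <= 2^-1 ->
  q * expR u + (1 - q) <= expR (u ^+ 2 / 2 + u * q).
Proof.
move=> /andP[q0 q1] hu.
have [u1 u2] : - 2^-1 <= u /\ u <= 2^-1 by apply/andP; rewrite -ler_norml.
have h1 : expR (u * (1 - q)) <= 1 + u * (1 - q) + 2 * (u * (1 - q)) ^+ 2.
  apply: expR_le_quadratic; rewrite normrM (ger0_norm (_ : 0 <= 1 - q)); last lra.
  by apply: le_trans hu; rewrite ler_piMr// lerBlDr lerDl.
have h2 : expR (- (u * q)) <= 1 - u * q + 2 * (u * q) ^+ 2.
  have := @expR_le_quadratic R (- (u * q)); rewrite sqrrN; apply.
  rewrite normrN normrM (ger0_norm q0).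
  by apply: le_trans hu; rewrite ler_piMr.
have h : q * expR (u * (1 - q)) + (1 - q) * expR (- (u * q)) <= expR (u ^+ 2 / 2).
  apply: le_trans (expR_ge1Dx _).
  apply: (@le_trans _ _ (1 + 2 * u ^+ 2 * (q * (1 - q)))).
    have := ler_wpM2l q0 h1.
    have q1' : 0 <= 1 - q by lra.
    have := ler_wpM2l q1' h2.
    by move=> A B; apply: (le_trans (lerD B A)); lra.
  rewrite lerD2l (_ : u ^+ 2 / 2 = 2 * u ^+ 2 * 4^-1); last by field.
  apply: ler_wpM2l; first by rewrite mulr_ge0// sqr_ge0.
  by have := sqr_ge0 (q - 2^-1); lra.
rewrite expRD -ler_pdivrMr ?expR_gt0// -expRN mulrDl -mulrA -expRD.
by rewrite (_ : u - u * q = u * (1 - q)); [exact: h|ring].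
Qed.

(* Chernoff bound with tilting parameter x / W: since W bounds the weights and
   x <= 1/2, all exponents stay in the range of [expR_le_quadratic]. *)
Lemma weighted_bernoulli_tail (R : realType) (I : finType) (q a : I -> R)
    (W x : R) :
  (forall i, 0 <= q i <= 1) -> (forall i, `|a i| <= W) ->
  \sum_i `|a i| <= 1 -> 0 < W -> 0 <= x <= 2^-1 ->
  \sum_(J : {set I} | x <= \sum_(i in J) a i - \sum_i a i * q i)
     \prod_i (if i \in J then q i else 1 - q i)
  <= expR (- (x ^+ 2 / (2 * W))).
Proof.
move=> q01 aW a1 W0 /andP[x0 x2].
set s := x / W.
have s0 : 0 <= s by rewrite divr_ge0// ltW.
have prod_ge0 (J : {set I}) :
    0 <= \prod_i (if i \in J then q i else 1 - q i).
  by apply: prodr_ge0 => i _; have := q01 i; case: ifP => _; lra.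
(* Markov's step: on the event the exponential factor is at least 1, elsewhere it only adds
   nonnegative terms. *)
apply: (@le_trans _ _ (\sum_(J : {set I})
   expR (s * (\sum_(i in J) a i - \sum_i a i * q i - x)) *
     \prod_i (if i \in J then q i else 1 - q i))).
  rewrite big_mkcond; apply: ler_sum => J _; case: ifPn => hJ.
    apply: ler_peMl; first exact: prod_ge0.
    by rewrite -expR0 ler_expR mulr_ge0// subr_ge0.
  by rewrite mulr_ge0// expR_ge0.
pose c := s * (- \sum_i a i * q i - x).
(* Expanding the product of binomials yields one term per subset [J]; this is the factorization of
   the moment generating function under independence. *)
have -> : \sum_(J : {set I})
   expR (s * (\sum_(i in J) a i - \sum_i a i * q i - x)) *
     \prod_i (if i \in J then q i else 1 - q i) =
   expR c * \prod_i (q i * expR (s * a i) + (1 - q i)).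
  rewrite bigA_distr mulr_sumr; apply: eq_bigr => J _.
  have -> : s * (\sum_(i in J) a i - \sum_i a i * q i - x) =
      c + s * \sum_(i in J) a i by rewrite /c; ring.
  rewrite expRD -mulrA; congr (_ * _).
  rewrite mulr_sumr expR_sum big_mkcond -big_split/=; apply: eq_bigr => i _.
  by case: ifP => _; rewrite ?mul1r// mulrC.
have sa i : `|s * a i| <= 2^-1.
  rewrite normrM ger0_norm//; apply: le_trans x2.
  by rewrite /s mulrAC ler_pdivrMr// ler_wpM2l.
apply: (@le_trans _ _ (expR c * \prod_i expR ((s * a i) ^+ 2 / 2 + s * a i * q i))).
  rewrite ler_pM2l ?expR_gt0//; apply: ler_prod => i _; apply/andP; split.
    have := q01 i; have := expR_ge0 (s * a i) => e0 /andP[q0 q1].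
    by rewrite addr_ge0 ?mulr_ge0// subr_ge0.
  exact: bernoulli_mgf_le.
rewrite -expR_sum -expRD ler_expR big_split/=.
have -> : \sum_i s * a i * q i = s * \sum_i a i * q i.
  by rewrite mulr_sumr; apply: eq_bigr => i _; rewrite mulrA.
(* Since [a i ^+ 2 <= W * |a i|], the total mass of [|a|] leaves a single factor [W]. *)
have h : \sum_i (s * a i) ^+ 2 / 2 <= s ^+ 2 * W / 2.
  rewrite -[leRHS]mulr1.
  apply: (@le_trans _ _ (s ^+ 2 * W / 2 * \sum_i `|a i|)).
    rewrite mulr_sumr; apply: ler_sum => i _.
    rewrite exprMn -(real_normK (num_real (a i))) [leRHS]mulrAC.
    rewrite ler_pM2r ?invr_gt0// -[leRHS]mulrA.
    apply: ler_wpM2l; first exact: sqr_ge0.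
    by rewrite expr2 ler_wpM2r.
  apply: ler_wpM2l => //.
  by rewrite mulr_ge0 ?invr_ge0// mulr_ge0 ?sqr_ge0 ?ltW.
(* The choice [s = x / W] minimizes [s ^+ 2 * W / 2 - s * x], with minimum [- x ^+ 2 / (2 * W)]. *)
have e1 : s * x = x ^+ 2 / W by rewrite /s; field; rewrite gt_eqF.
have e2 : s ^+ 2 * W / 2 = x ^+ 2 / W / 2 by rewrite /s; field; rewrite gt_eqF.
have e3 : x ^+ 2 / (2 * W) = x ^+ 2 / W / 2 by field; rewrite gt_eqF.
rewrite /c mulrBr e1 e3 mulrN.
by rewrite e2 in h; lra.
Qed.

(** * The random set of found indices and its product law *)

Definition found (d : measure_display) (Omega : measurableType d)
    (R : realType) (P : probability Omega R) (I : finType)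
    (T : I -> {RV P >-> R}) (t : R) (omega : Omega) : {set I} :=
  [set i | T i omega <= t]%SET.

Definition found_prob (d : measure_display) (Omega : measurableType d)
    (R : realType) (P : probability Omega R) (I : finType)
    (T : I -> {RV P >-> R}) (t : R) (i : I) : R :=
  fine (P (T i @^-1` `]-oo, t])).

Section found.
Context (d : measure_display) (Omega : measurableType d) (R : realType)
        (P : probability Omega R) (I : finType) (T : I -> {RV P >-> R}).

Lemma measurable_preimage_RV (X : {RV P >-> R}) (A : set R) :
  measurable A -> measurable (X @^-1` A).
Proof. by move=> mA; rewrite -[X in measurable X]setTI; exact: measurable_funP. Qed.

Lemma found_prob_itv t i : 0 <= found_prob T t i <= 1.
Proof.
rewrite /found_prob -!lee_fin fineK; last first.
  by apply: fin_num_measure; exact: measurable_preimage_RV.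
by rewrite measure_ge0 probability_le1//; exact: measurable_preimage_RV.
Qed.

(** The intersection runs over every index, with a half-line or its complement for each, because
    this is the shape to which [mutually_independent] applies. *)
Lemma preimage_found_set1 t (J : {set I}) :
  found T t @^-1` [set J] =
  \bigcap_(i in [set` [set: I]%SET])
    (T i @^-1` [set` if i \in J then `]-oo, t] else `]t, +oo[]).
Proof.
apply/seteqP; split => omega /=.
  move=> <- i _; rewrite /= /found finset.in_set.
  by case: (leP (T i omega) t) => h; rewrite in_itv/= ?h.
move=> h; apply/setP => i; rewrite inE.
have /= := h i; rewrite inE => /(_ isT).
by case: (i \in J); rewrite /= in_itv/= ?andbT// => /lt_geF.
Qed.

Lemma measurable_found t (Q : pred {set I}) :
  measurable (found T t @^-1` [set` Q]).
Proof.
have -> : found T t @^-1` [set` Q] =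
    \bigcup_(J in [set` Q]) (found T t @^-1` [set J]).
  by apply/seteqP; split => omega /=; [exists (found T t omega)|case=> J QJ ->].
apply: fin_bigcup_measurable; first exact: finite_finset.
move=> J _; rewrite preimage_found_set1.
apply: fin_bigcap_measurable; first exact: finite_finset.
by move=> i _; apply: measurable_preimage_RV; case: ifP => _; exact: measurable_itv.
Qed.

Hypothesis indepT : mutually_independent T.

Lemma found_set1_prob t (J : {set I}) :
  P (found T t @^-1` [set J]) =
  (\prod_i (if i \in J then found_prob T t i else 1 - found_prob T t i))%:E.
Proof.
rewrite preimage_found_set1 indepT; last first.
  by move=> i _; case: ifP => _; exact: measurable_itv.
rewrite -prodEFin big_mkcond; apply: eq_bigr => i _; rewrite inE.
have mT : measurable (T i @^-1` `]-oo, t]).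
  by apply: measurable_preimage_RV; exact: measurable_itv.
have fE : P (T i @^-1` `]-oo, t]) = (found_prob T t i)%:E.
  by rewrite /found_prob fineK//; exact: fin_num_measure.
case: ifP => _; rewrite ?fE//.
by rewrite -setCitvl preimage_setC probability_setC ?fE.
Qed.

(** Finite additivity over the disjoint atoms, one per subset, turns any event about [found] into a
    finite sum. *)
Lemma found_set_prob t (Q : pred {set I}) :
  P (found T t @^-1` [set` Q]) =
  (\sum_(J | Q J)
     \prod_i (if i \in J then found_prob T t i else 1 - found_prob T t i))%:E.
Proof.
have -> : found T t @^-1` [set` Q] =
    \bigcup_(J in [set` Q]) (found T t @^-1` [set J]).
  by apply/seteqP; split => omega /=; [exists (found T t omega)|case=> J QJ ->].
rewrite content_fin_bigcup; last 4 first.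
- exact: finite_finset.
- by apply/trivIsetP => J K _ _ /eqP JK; apply/seteqP; split => // omega /= [-> /JK].
- move=> J _; rewrite (_ : [set J] = [set` pred1 J]); first exact: measurable_found.
  by apply/seteqP; split => K /=; rewrite ?inE => /eqP.
- apply: fin_bigcup_measurable; first exact: finite_finset.
  move=> J _; rewrite (_ : [set J] = [set` pred1 J]); first exact: measurable_found.
  by apply/seteqP; split => K /=; rewrite ?inE => /eqP.
rewrite (@fsbigE _ _ _ _ _ (enum Q)) ?enum_uniq//; last 2 first.
- by move=> J /=; rewrite mem_enum.
- by move=> J /= QJ; rewrite mem_enum; move/negP.
rewrite -sumEFin big_enum_cond/=; apply: eq_big => J; last by rewrite found_set1_prob.
by rewrite mem_setE andbb.
Qed.

End found.

(** * Discovered mass, its mean, and the quorum time *)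

Section mass.
Context (d : measure_display) (Omega : measurableType d) (R : realType)
        (P : probability Omega R) (N : nat) (w : 'I_N -> R)
        (T : 'I_N -> {RV P >-> R}).

Lemma discovered_massE t omega :
  discovered_mass w T t omega = \sum_(i in found T t omega) w i.
Proof.
rewrite /discovered_mass [RHS]big_mkcond; apply: eq_bigr => i _.
rewrite indicE finset.in_set; case: (boolP (T i omega <= t)) => h.
  by rewrite mem_set// mulr1.
by rewrite memNset ?mulr0//; apply/negP.
Qed.

Lemma mean_profileE t : (forall i, 0 <= w i) ->
  mean_profile w T t = \sum_i w i * found_prob T t i.
Proof.
move=> w0; rewrite /mean_profile unlock.
have mT i : measurable [set u | T i u <= t].
  rewrite (_ : [set u | T i u <= t] = T i @^-1` `]-oo, t]).
    by apply: measurable_preimage_RV; exact: measurable_itv.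
  by apply/seteqP; split => u /=; rewrite in_itv.
under eq_integral do rewrite /discovered_mass -sumEFin.
rewrite ge0_integral_sum//; last 2 first.
- move=> i; apply/measurable_EFinP; apply: measurable_funM => //.
- by move=> i omega _; rewrite lee_fin mulr_ge0.
rewrite (eq_bigr (fun i => (w i * found_prob T t i)%:E)) => [|i _].
  by rewrite sumEFin.
under eq_integral do rewrite EFinM.
rewrite ge0_integralZl_EFin//; last first.
  by apply/measurable_EFinP; exact: measurable_indic.
rewrite integral_indic// setIT EFinM; congr (_ * _)%E.
rewrite /found_prob (_ : T i @^-1` _ = [set u | T i u <= t]).
  by rewrite fineK ?fin_num_measure//.
by apply/seteqP; split => u /=; rewrite in_itv.
Qed.

Lemma discovered_mass_le s t omega : (forall i, 0 <= w i) -> s <= t ->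
  discovered_mass w T s omega <= discovered_mass w T t omega.
Proof.
move=> w0 st; rewrite !discovered_massE [leLHS]big_mkcond [leRHS]big_mkcond.
apply: ler_sum => i _; rewrite !finset.in_set.
by case: ifP => [h|_]; [rewrite (le_trans h)|case: ifP].
Qed.

(** Provides a point in the set whose infimum is [quorum_time], so that this infimum is not a
    default value. *)
Lemma discovered_mass_full omega : exists2 t, 0 <= t &
  discovered_mass w T t omega = \sum_i w i.
Proof.
(* This time is nonnegative and dominates every [T i omega]. *)
exists (\sum_i `|T i omega|); first exact: sumr_ge0.
rewrite discovered_massE; apply: eq_bigl => i; rewrite finset.in_set.
apply: le_trans (ler_norm _) _.
by rewrite (bigD1 i)//= lerDl sumr_ge0.
Qed.

Section quorum.
Variable theta : R.
Hypotheses (w_ge0 : forall i, 0 <= w i) (w_sum : theta < \sum_i w i).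

Lemma quorum_time_le t omega : 0 <= t ->
  theta < discovered_mass w T t omega -> quorum_time w T theta omega <= t.
Proof. by move=> t0 h; apply: ge_inf => //; exists 0 => s []. Qed.

Lemma quorum_time_lt t omega : quorum_time w T theta omega < t ->
  exists2 s, 0 <= s < t & theta < discovered_mass w T s omega.
Proof.
move=> /inf_lt[]; last by move=> s [s0 h] st; exists s => //; rewrite s0.
by have [s s0 h] := discovered_mass_full omega; exists s; split; rewrite ?h.
Qed.

Lemma measurable_discovered_mass_gt t :
  measurable [set omega | theta < discovered_mass w T t omega].
Proof.
have := measurable_found T t (fun J => theta < \sum_(i in J) w i).
by congr (measurable _); apply/seteqP; split => omega /=; rewrite discovered_massE.
Qed.

(** The event that the quorum time is below [r] is the union, over rational [q] in [[0, r)], of the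
    events that the mass at time [q] exceeds [theta]: by monotonicity of the mass, a real witness
    can be moved up to a rational one still below [r]. *)
Lemma measurable_quorum_time : measurable_fun setT (quorum_time w T theta).
Proof.
apply: (measurability _ (RGenCInfty.measurableE R)) => /= _ [_] [r] -> <-.
pose F (q : rat) : set Omega :=
  if 0 <= (ratr q : R) < r then [set omega | theta < discovered_mass w T (ratr q) omega]
  else set0.
suff -> : quorum_time w T theta @^-1` `[r, +oo[ = ~` \bigcup_q F q.
  rewrite setTI; apply: measurableC; apply: bigcupT_measurable_rat => q.
  rewrite /F; case: ifP => _; last exact: measurable0.
  exact: measurable_discovered_mass_gt.
apply/seteqP; split => omega /=; rewrite in_itv/= andbT.
  move=> h [q _]; rewrite /F; case: ifP => // /andP[q0 qr] /= /(quorum_time_le q0).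
  by move=> /le_lt_trans/(_ qr); rewrite ltNge h.
move=> h; rewrite leNgt; apply/negP => /quorum_time_lt[s /andP[s0 sr] hs].
have [q] := rat_in_itvoo sr; rewrite in_itv/= => /andP[sq qr].
apply: h; exists q => //; rewrite /F (le_trans s0 (ltW sq)) qr/=.
by apply: lt_le_trans hs _; apply: discovered_mass_le => //; exact: ltW.
Qed.

End quorum.

Hypothesis indepT : mutually_independent T.

(** The coefficients may have any sign, so that [w] gives the upper tail and [- w] the lower one. *)
Lemma found_weight_tail (t W x : R) (a : 'I_N -> R) :
  (forall i, `|a i| <= W) -> \sum_i `|a i| <= 1 -> 0 < W -> 0 <= x <= 2^-1 ->
  (P [set omega | (x <= \sum_(i in found T t omega) a i
                        - \sum_i a i * found_prob T t i)%R]
   <= (expR (- (x ^+ 2 / (2 * W))))%:E)%E.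
Proof.
move=> aW a1 W0 x01.
rewrite (found_set_prob indepT t
  (fun J => x <= \sum_(i in J) a i - \sum_i a i * found_prob T t i)) lee_fin.
apply: weighted_bernoulli_tail => // i; exact: found_prob_itv.
Qed.

End mass.

(** * Exponential laws and the explicit mean profile *)

Lemma exponential_prob_itvNyc (R : realType) (rate t : R) :
  0 < rate -> 0 <= t ->
  exponential_prob rate `]-oo, t] = (1 - expR (- (rate * t)))%:E.
Proof.
move=> rate0 t0.
(* The density vanishes on the negative axis, so only [[0, t]] counts; at [t = 0] this interval is a
   single point of mass zero. *)
have e0 : exponential_prob rate `[0, t] = (1 - expR (- (rate * t)))%:E.
  have [t_gt0|t_le0] := ltP 0 t.
    by rewrite exponential_prob_itv0c// mulNr EFinB.
  have -> : t = 0 by apply/eqP; rewrite eq_le t0 t_le0.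
  by rewrite mulr0 oppr0 expR0 subrr set_itv1 /exponential_prob integral_set1.
rewrite -e0 /exponential_prob (@itv_bndbnd_setU _ _ _ (BLeft 0))//.
rewrite ge0_integral_setU//=; last 3 first.
- apply/measurable_EFinP; apply: measurable_funTS.
  exact: measurable_exponential_pdf.
- by move=> x _; rewrite lee_fin exponential_pdf_ge0// ltW.
- apply/disj_setPS => x [] /=; rewrite !in_itv/= => x0 /andP[].
  by rewrite leNgt x0.
rewrite integral0_eq ?add0e// => x /=; rewrite in_itv/= => x0.
by rewrite lt0_exponential_pdf.
Qed.

Lemma found_prob_exponential (d : measure_display) (Omega : measurableType d)
    (R : realType) (P : probability Omega R) (I : finType)
    (T : I -> {RV P >-> R}) (rate : R) (i : I) (t : R) :
  exponentially_distributed (T i) rate -> 0 < rate -> 0 <= t ->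
  found_prob T t i = 1 - expR (- (rate * t)).
Proof.
move=> expT rate0 t0; rewrite /found_prob.
have := expT _ (measurable_itv `]-oo, t]).
by rewrite exponential_prob_itvNyc// /distribution /pushforward => ->.
Qed.

Section exponential_mixture.
Context (R : realType) (N : nat) (w rate : 'I_N -> R).
Hypotheses (w_gt0 : forall i, 0 < w i) (w_sum : \sum_i w i = 1)
           (rate_gt0 : forall i, 0 < rate i).

Let m t := \sum_i w i * (1 - expR (- (rate i * t))).

Lemma exponential_mixture_lt s t : s < t -> m s < m t.
Proof.
move=> st; apply: ltr_sum => [|i _].
  (* Strictness requires at least one index: an empty family of weights would sum to 0 instead of
     1. *)
  apply/hasP; case: N w w_sum => [w'|n w' _]; last first.
    by exists ord0 => //; exact: mem_index_enum.
  by rewrite big_ord0 => /esym/eqP; rewrite oner_eq0.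
by rewrite ltr_pM2l// ltrD2l ltrN2 ltr_expR ltrN2 ltr_pM2l.
Qed.

Lemma continuous_exponential_mixture : continuous m.
Proof.
move=> x; apply: cvg_big => [|i _]; first exact: add_continuous.
apply: cvgMr; apply: cvgB; first exact: cvg_cst.
apply: continuous_comp; last exact: continuous_expR.
by apply: cvgN; apply: cvgMr; exact: cvg_id.
Qed.

Lemma exponential_mixture_surj theta : 0 < theta < 1 ->
  exists2 t, 0 <= t & m t = theta.
Proof.
move=> /andP[theta0 theta1].
(* Each summand is nonnegative, so [b] is at least [- ln (1 - theta) / rate i] for every [i]; each
   [1 - expR (- (rate i * b))] is then at least [theta], and so is their average [m b]. *)
pose b := \sum_i - ln (1 - theta) / rate i.
have l0 : 0 <= - ln (1 - theta) by rewrite oppr_ge0 ln_le0// gerBl ltW.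
have b0 : 0 <= b by apply: sumr_ge0 => i _; rewrite divr_ge0// ltW.
have m0 : m 0 = 0.
  by apply: big1 => i _; rewrite mulr0 oppr0 expR0 subrr mulr0.
have mb : theta <= m b.
  rewrite -[theta]mul1r -w_sum mulr_suml; apply: ler_sum => i _.
  rewrite ler_pM2l// lerBrDr -lerBrDl -[leRHS]lnK ?posrE ?subr_gt0//.
  rewrite ler_expR lerNl -ler_pdivrMl// mulrC /b (bigD1 i)//= lerDl.
  by apply: sumr_ge0 => j _; rewrite divr_ge0// ltW.
have mb0 : m 0 <= m b by rewrite m0 (le_trans (ltW theta0)).
have [||t] := @IVT _ m 0 b theta b0.
- exact/continuous_subspaceT/continuous_exponential_mixture.
- by rewrite min_l// max_r// m0 ltW.
- by rewrite in_itv/= => /andP[t0 _] mt; exists t.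
Qed.

End exponential_mixture.

(** * Deviation of the quorum time from the comparison time *)

Theorem theorem3p4 (R : realType) (d : measure_display)
    (Omega : measurableType d) (P : probability Omega R)
    (N : nat) (w p : 'I_N -> R) (lambda : R) (T : 'I_N -> {RV P >-> R})
    (theta delta : R) :
  positive_probability_vector w ->
  positive_probability_vector p ->
  0 < lambda ->
  mutually_independent T ->
  (forall i, exponentially_distributed (T i) (lambda * p i)) ->
  0 < theta < 1 ->
  0 < delta < comparison_time w T theta ->
  let Delta := profile_gap w T theta delta in
  let wmax := max_weight w in
  0 < Delta /\
  (P [set omega | (delta < `|quorum_time w T theta omega
                             - comparison_time w T theta|)%R]
   <= (4 * expR (- (Delta ^+ 2 / (2 * wmax + 2 / 3 * wmax * Delta))))%:E)%E.
Proof.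
move=> [w_gt0 w_sum] [p_gt0 _] lambda_gt0 indepT expT theta01 /andP[delta_gt0].
have w_ge0 i : 0 <= w i by exact: ltW.
have rate_gt0 i : 0 < lambda * p i by exact: mulr_gt0.
have mE t : 0 <= t ->
    mean_profile w T t = \sum_i w i * (1 - expR (- (lambda * p i * t))).
  move=> t0; rewrite mean_profileE//; apply: eq_bigr => i _.
  by rewrite (found_prob_exponential (expT i)).
have m_lt s t : 0 <= s -> s < t -> mean_profile w T s < mean_profile w T t.
  move=> s0 st; rewrite !mE ?(le_trans s0 (ltW st))//.
  exact: exponential_mixture_lt.
have [t_ge0 mt] : 0 <= comparison_time w T theta /\
    mean_profile w T (comparison_time w T theta) = theta.
  (* Existence of a solution ensures that [xget] returns one rather than its default. *)
  apply: (@xgetPex _ 0 [set t | 0 <= t /\ mean_profile w T t = theta]).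
  have [t t0 <-] := exponential_mixture_surj w_gt0 w_sum rate_gt0 theta01.
  by exists t; split => //; exact: mE.
set t := comparison_time w T theta in t_ge0 mt *; move=> delta_lt.
have tB_ge0 : 0 <= t - delta by rewrite subr_ge0 ltW.
have tD_ge0 : 0 <= t + delta by rewrite addr_ge0// ltW.
have mB : mean_profile w T (t - delta) < theta.
  by rewrite -mt; apply: m_lt => //; rewrite gtrBl.
have mD : theta < mean_profile w T (t + delta).
  by rewrite -[X in X < _]mt; apply: m_lt => //; rewrite ltrDl.
have m01 s : 0 <= mean_profile w T s <= 1.
  rewrite mean_profileE// -[X in _ <= _ <= X]w_sum; apply/andP; split.
    by apply: sumr_ge0 => i _; rewrite mulr_ge0//; case/andP: (found_prob_itv T s i).
  by apply: ler_sum => i _; rewrite ler_piMr//; case/andP: (found_prob_itv T s i).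
move=> Delta wmax.
have Delta_gt0 : 0 < Delta by rewrite lt_min !subr_gt0 mB.
split=> //.
have DeltaB : Delta <= theta - mean_profile w T (t - delta).
  by rewrite ge_min lexx.
have DeltaD : Delta <= mean_profile w T (t + delta) - theta.
  by rewrite ge_min lexx orbT.
(* The two gaps add up to the increase of the mean profile from [t - delta] to [t + delta], at most
   1, so the smaller is at most 1/2. *)
have Delta_le : 0 <= Delta <= 2^-1.
  rewrite ltW//=; have /andP[m0 _] := m01 (t - delta).
  by have /andP[_ m1] := m01 (t + delta); lra.
have w_le i : `|w i| <= wmax by rewrite gtr0_norm//; exact: le_bigmax.
have w_norm : \sum_i `|w i| <= 1.
  by rewrite (eq_bigr w) ?w_sum// => i _; rewrite gtr0_norm.
have wmax_gt0 : 0 < wmax.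
  rewrite ltNge; apply/negP => wmax_le0.
  have : \sum_i w i <= 0.
    apply: sumr_le0 => i _; apply: le_trans wmax_le0.
    by rewrite -(gtr0_norm (w_gt0 i)).
  by rewrite w_sum ler10.
have tail (a : 'I_N -> R) s : (forall i, `|a i| = `|w i|) ->
   (P [set omega | (Delta <= \sum_(i in found T s omega) a i
                        - \sum_i a i * found_prob T s i)%R]
   <= (expR (- (Delta ^+ 2 / (2 * wmax))))%:E)%E.
  move=> aw; apply: found_weight_tail => // [i|]; first by rewrite aw.
  by rewrite (eq_bigr (fun i => `|w i|)).
set A := [set omega | Delta <= \sum_(i in found T (t - delta) omega) w i
                        - \sum_i w i * found_prob T (t - delta) i].
(* With the signs reversed, [B] says that the mass at [t + delta] lies below its mean by at least
   [Delta]. *)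
set B := [set omega | Delta <= \sum_(i in found T (t + delta) omega) - w i
                        - \sum_i - w i * found_prob T (t + delta) i].
have mA : measurable A.
  exact: (measurable_found T (t - delta) (fun J => Delta <= \sum_(i in J) w i
                        - \sum_i w i * found_prob T (t - delta) i)).
have mBset : measurable B.
  exact: (measurable_found T (t + delta) (fun J => Delta <= \sum_(i in J) - w i
                        - \sum_i - w i * found_prob T (t + delta) i)).
have theta_lt : theta < \sum_i w i by rewrite w_sum; case/andP: theta01.
have mE' : measurable [set omega | (delta < `|quorum_time w T theta omega - t|)%R].
  have mf : measurable_fun setT (fun omega => `|quorum_time w T theta omega - t|).
    apply: measurableT_comp => //; apply: measurable_funB => //.
    exact: measurable_quorum_time.
  have := mf measurableT _ (measurable_itv `]delta, +oo[); rewrite setTI.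
  by congr (measurable _); apply/seteqP; split => omega /=; rewrite in_itv/= andbT.
apply: (@le_trans _ _ (P (A `|` B))).
  apply: le_measure; rewrite ?inE//; first exact: measurableU.
  (* A late quorum falls in [B], an early one in [A]. *)
  move=> omega /=; rewrite lter_normr => /orP[h|h].
    right; rewrite /B/= sumrN -discovered_massE.
    under eq_bigr do rewrite mulNr.
    rewrite sumrN opprK -mean_profileE//.
    apply: le_trans DeltaD _; rewrite addrC lerD2r lerN2 leNgt.
    apply/negP => /(quorum_time_le tD_ge0); lra.
  left; rewrite /A/= -discovered_massE -mean_profileE//.
  have /(quorum_time_lt theta_lt)[s /andP[_ st] hs] :
    quorum_time w T theta omega < t - delta by lra.
  have := discovered_mass_le T omega w_ge0 (ltW st); lra.
apply: le_trans (measureU2 _ mA mBset) _.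
apply: (@le_trans _ _ ((2 * expR (- (Delta ^+ 2 / (2 * wmax))))%:E)).
  rewrite mulr2n mulrDl mul1r EFinD; apply: leeD; apply: tail => // i.
  by rewrite normrN.
(* The remaining comparison only loses: 2 is raised to 4, and the denominator [2 * wmax] grows by a
   nonnegative term. *)
rewrite lee_fin; apply: ler_pM; rewrite ?expR_ge0// ?ler_nat//.
rewrite ler_expR lerN2; apply: ler_wpM2l; first exact: sqr_ge0.
have ge0 : 0 <= 2 / 3 * wmax * Delta by rewrite !mulr_ge0 ?invr_ge0// ltW.
by rewrite lef_pV2 ?posrE ?lerDl ?addr_gt0 ?mulr_gt0 ?invr_gt0.
Qed.
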